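(* Let real numbers $s_{m,n}$, $m,n\in\{0,1\}$, be given, and consider the truncated two-dimensional moment problem with $M=1$, $N=1$: find a non-negative measure $\mu$ on $\mathfrak{B}(\mathbb{R}^2)$ such that $\int_{\mathbb{R}^2} x_1^m x_2^n\, d\mu = s_{m,n}$ for all $m,n\in\{0,1\}$. This moment problem has a solution if and only if one of the following conditions holds: (i) $s_{0,0}=s_{0,1}=s_{1,0}=s_{1,1}=0$; (ii) $s_{0,0}>0$. In case (i) the unique solution is $\mu\equiv 0$. In case (ii), for arbitrary real $a_0 < \frac{s_{0,1}}{s_{0,0}}$ and $a_1 > \frac{s_{0,1}}{s_{0,0}}$, the truncated $K_1(a_0,a_1)$-moment problem with the same data $\{s_{m,n}\}_{m,n\in\{0,1\}}$ is solvable, and thus a solution $\mu$ of the moment problem can be obtained as a solution of this truncated $K_1(a_0,a_1)$-moment problem.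
   Context: $\mathfrak{B}(\mathbb{R}^2)$ denotes the Borel subsets of $\mathbb{R}^2$, and $x^0=1$ by convention. A solution of a moment problem is a non-negative Borel measure for which all the listed integrals exist (converge absolutely) and have the prescribed values. For real $a_0<a_1$, set $K_1(a_0,a_1)=L_0\cup L_1$, where $L_j=\{(x_1,x_2)\in\mathbb{R}^2: x_2=a_j\}$. For a set $K\subseteq\mathbb{R}^2$, the truncated $K$-moment problem with data $\{s_{m,n}\}_{0\le m\le M,\,0\le n\le N}$ is: find a non-negative measure $\mu$ on $\mathfrak{B}(\mathbb{R}^2)$ with $\int_{\mathbb{R}^2}x_1^m x_2^n\,d\mu=s_{m,n}$ for all $0\le m\le M$, $0\le n\le N$, and $\mathrm{supp}\,\mu\subseteq K$. *)

(* Defs.v *)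
From HB Require Import structures.
From mathcomp Require Import all_boot all_order all_algebra.
From mathcomp Require Import all_classical all_reals all_analysis.

Set Implicit Arguments.
Unset Strict Implicit.
Unset Printing Implicit Defensive.

Import Order.TTheory GRing.Theory Num.Theory.
Import numFieldNormedType.Exports.

Local Open Scope classical_set_scope.
Local Open Scope ring_scope.

Definition borel_plane (R : realType) := g_sigma_algebraType (@open (R * R)%type).

Definition monomial2 (R : realType) (m n : nat) (x : borel_plane R) : R :=
  x.1 ^+ m * x.2 ^+ n.

(* Integrability is required separately because the library integral is total. *)
Definition moment_solution (R : realType) (M N : nat)
    (s : 'I_M.+1 -> 'I_N.+1 -> R)
    (mu : {measure set (borel_plane R) -> \bar R}) : Prop :=
  forall (m : 'I_M.+1) (n : 'I_N.+1),
    mu.-integrable setT (fun x => (monomial2 m n x)%:E) /\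
    (\int[mu]_x (monomial2 m n x)%:E = (s m n)%:E)%E.

Definition msupport (R : realType)
    (mu : {measure set (borel_plane R) -> \bar R}) : set (R * R) :=
  [set x | forall U : set (R * R), open U -> U x -> (0 < mu U)%E].

Definition K_moment_solution (R : realType) (K : set (R * R)) (M N : nat)
    (s : 'I_M.+1 -> 'I_N.+1 -> R)
    (mu : {measure set (borel_plane R) -> \bar R}) : Prop :=
  moment_solution s mu /\ msupport mu `<=` K.

Definition hline (R : realType) (a : R) : set (R * R) := [set x | x.2 = a].

Definition K1 (R : realType) (a0 a1 : R) : set (R * R) := hline a0 `|` hline a1.

(* Main.v *)
Require Import Defs.
From HB Require Import structures.
From mathcomp Require Import all_boot all_order all_algebra.
From mathcomp Require Import all_classical all_reals all_analysis.
From mathcomp Require Import measurable_realfun ring lra.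

Import Order.TTheory GRing.Theory Num.Theory.
Import numFieldNormedType.Exports.

Local Open Scope classical_set_scope.
Local Open Scope ring_scope.

(** The zeroth moment of a measure is its total mass.  So if a solution exists
    then [s 0 0 >= 0], and if [s 0 0 = 0] the solution vanishes on every Borel
    set, which forces every other moment to be [0] as well
    ([moment_solution_null]); this gives necessity of the alternative and
    uniqueness in case (i).

    In case (ii) a solution supported on the two lines [x2 = a0] and [x2 = a1]
    is found with one atom on each line, of weights [w0] and [w1] and abscissas
    [t0] and [t1].  The moment equations split into the two linear systems

      [w0 + w1 = s 0 0],            [a0 w0 + a1 w1 = s 0 1],
      [w0 t0 + w1 t1 = s 1 0],      [a0 (w0 t0) + a1 (w1 t1) = s 1 1],

    both with the Vandermonde determinant [a1 - a0].  The first one determines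
    the weights, which are positive exactly because [a0 < s 0 1 / s 0 0 < a1];
    the second one determines the products [w_j t_j], and dividing by the
    positive weights yields the abscissas. *)

(** * Integration against a two-atom measure *)

Section TwoAtoms.
Context d (T : measurableType d) (R : realType).
Implicit Types (w : {nonneg R}) (p : T) (f : T -> R).

Lemma ge0_integral_mscale_dirac w p f :
    measurable_fun setT f -> (forall x, 0 <= f x) ->
  (\int[mscale w (@dirac _ T p R)]_x (f x)%:E = (w%:num * f p)%:E)%E.
Proof.
move=> /measurable_EFinP mf f0.
rewrite ge0_integral_mscale//; last by move=> x _; rewrite lee_fin.
by rewrite integral_dirac// diracT mul1e.
Qed.

Lemma integrable_mscale_dirac w p f : measurable_fun setT f ->
  (mscale w (@dirac _ T p R)).-integrable setT (fun x => (f x)%:E).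
Proof.
move=> mf; apply/integrableP; split; first exact/measurable_EFinP.
rewrite (_ : (fun x => `|(f x)%:E|%E) = fun x => (`|f x|)%:E)//.
by rewrite ge0_integral_mscale_dirac ?ltry//; exact: measurableT_comp.
Qed.

(** The formula for nonnegative integrands, applied to the positive and the
    negative part of [f]. *)
Lemma integral_mscale_dirac w p f : measurable_fun setT f ->
  (\int[mscale w (@dirac _ T p R)]_x (f x)%:E = (w%:num * f p)%:E)%E.
Proof.
move=> mf; rewrite integralE.
under eq_integral do rewrite funeposE -EFin_max.
under [X in (_ - X)%E]eq_integral do rewrite funenegE -EFinN -EFin_max.
rewrite !ge0_integral_mscale_dirac//.
- rewrite -EFinB -mulrBr; congr (_ * _)%:E.
  by rewrite /Num.max; case: ifPn; case: ifPn; lra.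
- by apply: measurable_maxr => //; exact: measurableT_comp.
- by move=> x; rewrite le_max lexx orbT.
- exact: measurable_maxr.
- by move=> x; rewrite le_max lexx orbT.
Qed.

Definition two_atoms w0 w1 p0 p1 : {measure set T -> \bar R} :=
  measure_add (mscale w0 (@dirac _ T p0 R)) (mscale w1 (@dirac _ T p1 R)).

Lemma two_atomsE w0 w1 p0 p1 A :
  two_atoms w0 w1 p0 p1 A
  = (w0%:num%:E * \d_p0 A + w1%:num%:E * \d_p1 A)%E.
Proof. exact: measure_addE. Qed.

Lemma integral_two_atoms w0 w1 p0 p1 f : measurable_fun setT f ->
  (\int[two_atoms w0 w1 p0 p1]_x (f x)%:E
   = (w0%:num * f p0 + w1%:num * f p1)%:E)%E.
Proof.
move=> mf; rewrite integral_measure_add//.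
- by rewrite !integral_mscale_dirac.
- exact: integrable_mscale_dirac.
- exact: integrable_mscale_dirac.
Qed.

Lemma integrable_two_atoms w0 w1 p0 p1 f : measurable_fun setT f ->
  (two_atoms w0 w1 p0 p1).-integrable setT (fun x => (f x)%:E).
Proof.
move=> mf; apply/integrableP; split; first exact/measurable_EFinP.
rewrite (_ : (fun x => `|(f x)%:E|%E) = fun x => (`|f x|)%:E)//.
by rewrite integral_two_atoms ?ltry//; exact: measurableT_comp.
Qed.

End TwoAtoms.

(** * Borel structure of the plane *)

Section BorelPlane.
Context {R : realType}.
Implicit Type mu : {measure set (borel_plane R) -> \bar R}.

(** The sigma-algebra of [borel_plane R] is generated by the open sets of the
    product topology rather than by measurable rectangles, so measurability
    comes from continuity. *)
Lemma continuous_measurable_borel_plane (f : R * R -> R) :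
  continuous f -> measurable_fun (setT : set (borel_plane R)) f.
Proof.
move=> cf; apply: (measurability _ (RGenOpens.measurableE R)).
move=> _ [_ [a [b ->]] <-]; rewrite setTI.
apply: sub_sigma_algebra.
by move/continuousP: cf; apply; exact: interval_open.
Qed.

Lemma measurable_monomial2 m n :
  measurable_fun setT (@monomial2 R m n).
Proof.
apply: continuous_measurable_borel_plane => x.
rewrite /monomial2; apply: cvgM.
- apply: (@continuous_comp _ _ _ fst (fun t : R => t ^+ m)).
    exact: cvg_fst.
  exact: exprn_continuous.
- apply: (@continuous_comp _ _ _ snd (fun t : R => t ^+ n)).
    exact: cvg_snd.
  exact: exprn_continuous.
Qed.

Lemma closed_hline (a : R) : closed (hline a).
Proof.
rewrite (_ : hline a = snd @^-1` [set a])//.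
apply: closed_comp => [x _|]; first exact: cvg_snd.
exact: closed_eq.
Qed.

(** The open complement of [K] is itself a null neighbourhood of each of its
    points. *)
Lemma msupport_sub mu (K : set (R * R)) :
  closed K -> mu (~` K) = 0%E -> msupport mu `<=` K.
Proof.
move=> cK muK x sx; apply: contrapT => nKx.
by have := sx _ (closed_openC cK) nKx; rewrite muK ltxx.
Qed.

Lemma moment_solution_mass (s : 'I_2 -> 'I_2 -> R) mu :
  moment_solution s mu -> mu setT = (s 0 0)%:E.
Proof.
move=> /(_ 0 0)[_ <-].
under eq_integral do rewrite /monomial2 !expr0 mulr1.
by rewrite integral_cst// mul1e.
Qed.

Lemma null_mass mu A : mu setT = 0%E -> measurable A -> mu A = 0%E.
Proof.
move=> mu0 mA; apply/eqP; rewrite eq_le measure_ge0 andbT -mu0.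
by apply: le_measure; rewrite ?inE.
Qed.

(** A measure of total mass [s 0 0 = 0] integrates every function to [0]. *)
Lemma moment_solution_null (s : 'I_2 -> 'I_2 -> R) mu m n :
  moment_solution s mu -> s 0 0 = 0 -> s m n = 0.
Proof.
move=> smu s0; have [/integrableP[mf _]] := smu m n.
have mu0 : mu setT = 0%E by rewrite (moment_solution_mass _ _ smu) s0.
by rewrite null_set_integral// => -[].
Qed.

End BorelPlane.

(** * The moment problem *)

Lemma I2_cases (i : 'I_2) : i = 0 \/ i = 1.
Proof. by case: i => [[|[|//]] ?]; [left|right]; exact: val_inj. Qed.

Section Solvability.
Context {R : realType}.
Variable s : 'I_2 -> 'I_2 -> R.

Lemma K1_solvable a0 a1 : 0 < s 0 0 -> a0 < s 0 1 / s 0 0 ->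
    s 0 1 / s 0 0 < a1 ->
  exists mu : {measure set (borel_plane R) -> \bar R},
    K_moment_solution (K1 a0 a1) s mu.
Proof.
move=> s0 h0 h1.
have a01 : 0 < a1 - a0 by rewrite subr_gt0 (lt_trans h0).
move: h0 h1; rewrite ltr_pdivlMr// ltr_pdivrMr// => h0 h1.
(* Cramer's rule for the system with unknowns w0 and w1, and below for the
   one with unknowns w0 * t0 and w1 * t1. *)
pose w0 := (a1 * s 0 0 - s 0 1) / (a1 - a0).
pose w1 := (s 0 1 - a0 * s 0 0) / (a1 - a0).
have w0_gt0 : 0 < w0 by rewrite divr_gt0// subr_gt0.
have w1_gt0 : 0 < w1 by rewrite divr_gt0// subr_gt0.
have w0_neq0 : w0 != 0 by rewrite gt_eqF.
have w1_neq0 : w1 != 0 by rewrite gt_eqF.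
have a01_neq0 : a1 - a0 != 0 by rewrite gt_eqF.
pose t0 := (a1 * s 1 0 - s 1 1) / (a1 - a0) / w0.
pose t1 := (s 1 1 - a0 * s 1 0) / (a1 - a0) / w1.
have w0t0 : w0 * t0 = (a1 * s 1 0 - s 1 1) / (a1 - a0).
  by rewrite mulrC divfK.
have w1t1 : w1 * t1 = (s 1 1 - a0 * s 1 0) / (a1 - a0).
  by rewrite mulrC divfK.
pose mu := @two_atoms _ (borel_plane R) R (NngNum (ltW w0_gt0))
  (NngNum (ltW w1_gt0)) (t0, a0) (t1, a1).
exists mu; split.
- move=> m n; split.
    by apply: integrable_two_atoms; exact: measurable_monomial2.
  rewrite integral_two_atoms; last exact: measurable_monomial2.
  congr EFin; rewrite /monomial2/= !mulrA.
  have [->|->] := I2_cases m; have [->|->] := I2_cases n;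
    rewrite /= ?expr0 ?expr1 ?mulr1 ?w0t0 ?w1t1 /w0 /w1; by field.
- apply: msupport_sub.
    by apply: closedU; exact: closed_hline.
  rewrite two_atomsE !diracE !memNset ?mule0 ?adde0//=.
  + by apply; right.
  + by apply; left.
Qed.

End Solvability.

Theorem theorem1 (R : realType) (s : 'I_2 -> 'I_2 -> R) :
  [/\ (exists mu : {measure set (borel_plane R) -> \bar R},
          moment_solution s mu) <->
        [/\ s 0 0 = 0, s 0 1 = 0, s 1 0 = 0 & s 1 1 = 0] \/ 0 < s 0 0,
      [/\ s 0 0 = 0, s 0 1 = 0, s 1 0 = 0 & s 1 1 = 0] ->
        moment_solution s (@mzero _ (borel_plane R) R) /\
        (forall mu : {measure set (borel_plane R) -> \bar R},
          moment_solution s mu ->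
          forall A : set (borel_plane R), measurable A -> mu A = 0%E) &
      0 < s 0 0 ->
        forall a0 a1 : R, a0 < s 0 1 / s 0 0 -> s 0 1 / s 0 0 < a1 ->
          (exists mu : {measure set (borel_plane R) -> \bar R},
            K_moment_solution (K1 a0 a1) s mu) /\
          (forall mu : {measure set (borel_plane R) -> \bar R},
            K_moment_solution (K1 a0 a1) s mu -> moment_solution s mu)].
Proof.
have zero_solves : [/\ s 0 0 = 0, s 0 1 = 0, s 1 0 = 0 & s 1 1 = 0] ->
    moment_solution s (@mzero _ (borel_plane R) R).
  move=> [s00 s01 s10 s11] m n; split.
    apply/integrableP; split.
      by apply/measurable_EFinP; exact: measurable_monomial2.
    by rewrite integral_measure_zero ltry.
  rewrite integral_measure_zero; congr EFin.
  by have [->|->] := I2_cases m; have [->|->] := I2_cases n.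
split.
- split=> [[mu smu]|[s0|s0]].
  + have : 0 <= s 0 0 by rewrite -lee_fin -(moment_solution_mass _ _ smu).
    rewrite le_eqVlt => /predU1P[/esym s0|]; last by right.
    by left; split; exact: (moment_solution_null _ _ _ _ smu s0).
  + by exists (@mzero _ (borel_plane R) R); exact: zero_solves.
  + have [||mu [smu _]] :=
      @K1_solvable R s (s 0 1 / s 0 0 - 1) (s 0 1 / s 0 0 + 1) s0.
    * by rewrite ltrBlDr ltrDl.
    * by rewrite ltrDl.
    * by exists mu.
- move=> s0; split; first exact: zero_solves.
  move=> mu smu A; apply: null_mass.
  by rewrite (moment_solution_mass _ _ smu); case: s0 => ->.
- move=> s0 a0 a1 h0 h1; split; first exact: K1_solvable.
  by move=> mu [].
Qed.
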